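(* Let $\alpha\in\mathbb{B}^d$ be a coefficient vector in the $d$-dimensional (Euclidean) unit ball $\mathbb{B}^d\subset\mathbb{R}^d$. Let $\mathcal{V}\sim\mathcal{D}^N$ be a validation set of size $N$ drawn i.i.d. from the test distribution $\mathcal{D}$. Let $$M(\theta)=\Psi(\phi_1(\theta),\dots,\phi_K(\theta)),\qquad \phi_k(\theta)=\mathbb{E}_{(x,y)\sim\mathcal{D}}[\ell_k(x,y;\theta)],$$ and denote the empirical versions by $$\hat M(\theta)=\Psi(\hat\phi_1(\theta),\dots,\hat\phi_K(\theta)),\qquad \hat\phi_k(\theta)=\frac1N\sum_{(x,y)\in\mathcal{V}}\ell_k(x,y;\theta).$$ Let $\hat\theta(\alpha)$ denote the model parameters obtained by example-weighted training with coefficient vector $\alpha$ (see context). Let $\alpha^*=\arg\max_{\alpha\in\mathbb{B}^d}M(\hat\theta(\alpha))$ be the optimal coefficient vector in the unit ball, and let $\hat\alpha=\arg\max_{\alpha\in\mathcal{A}}\hat M(\hat\theta(\alpha))$ be the empirically optimal coefficient vector among a candidate set $\mathcal{A}$. Assume: (A) for all $k$, $\ell_k$ is sub-Gaussian with parameter $\sigma$; (B) $\Psi$ is $L_\Psi$-Lipschitz continuous in $(\phi_1,\dots,\phi_K)$ with respect to the $L_2$ norm; (C) for all $k$, $\phi_k(\hat\theta(\alpha))$ is $L_\phi$-Lipschitz continuous in $\alpha$ with respect to the $L_2$ norm. Then for $N\ge 9\sigma^2K$, there is a candidate set $\mathcal{A}$ such that with probability at least $1-\delta$ (over the draw of $\mathcal{V}$),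 $$M(\hat\theta(\alpha^* ))-M(\hat\theta(\hat\alpha))\;\le\;\frac{\sigma L_\Psi\sqrt K}{\sqrt N}\left(\sqrt{4d\ln\frac{N}{\sigma^2}+8\ln\frac{2K}{\delta}}+3L_\phi\right).$$
   Context: Examples are pairs $(x,y)$ with $x\in\mathbb{R}^D$ and $y\in\mathcal{Y}\subseteq\mathbb{R}$. A model $h(x;\theta)$ is parameterized by $\theta\in\mathbb{R}^D$. $K\ge1$ and $d\ge1$ are integers, $\sigma>0$ and $\delta\in(0,1)$. For each $k\in\{1,\dots,K\}$, $\ell_k(x,y;\theta)\ge0$ is a loss on an individual example $(x,y)$ for the model with parameters $\theta$, and $\Psi:\mathbb{R}^K\to\mathbb{R}$ is a general function; $M$ is a metric to be maximized. ''$\ell_k$ is sub-Gaussian with parameter $\sigma$'' has its standard meaning: for every $\theta$, the random variable $X=\ell_k(x,y;\theta)$ with $(x,y)\sim\mathcal{D}$ satisfies $\mathbb{E}[e^{\lambda(X-\mathbb{E}X)}]\le e^{\lambda^2\sigma^2/2}$ for all $\lambda\in\mathbb{R}$. Weighted training: given a training set $\mathcal{T}$ of examples $(x_j,y_j)$ (separate from $\mathcal{V}$ and treated as fixed), a loss $L(\hat y,y)$ and a nonnegative example-weighting function $w(x,y;\alpha)$ with parameter $\alpha$, $$\hat\theta(\alpha)=\arg\min_\theta\sum_{j\in\mathcal{T}}w(x_j,y_j;\alpha)\,L(h(x_j;\theta),y_j).$$ The setting is that of an exhaustive search over a fixed candidate set $\mathcal{A}$ of coefficient vectors that covers the unit ball;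 in particular $\mathcal{A}$ does not depend on the draw of $\mathcal{V}$. *)

(* Defs.v *)
From HB Require Import structures.
From mathcomp Require Import all_boot all_order all_algebra.
From mathcomp Require Import all_classical all_reals all_analysis.
Set Implicit Arguments.
Unset Strict Implicit.
Unset Printing Implicit Defensive.
Import Order.TTheory GRing.Theory Num.Theory.
Import numFieldNormedType.Exports.

Local Open Scope classical_set_scope.
Local Open Scope ring_scope.

(* The norm that MathComp-Analysis puts on 'rV[R]_n is the sup norm, hence
   this separate Euclidean norm. *)
Definition l2norm (R : realType) (n : nat) (u : 'rV[R]_n) : R :=
  Num.sqrt (\sum_(i < n) u ord0 i ^+ 2).

Definition unit_ball (R : realType) (d : nat) : set 'rV[R]_d :=
  [set a | l2norm a <= 1].
Arguments unit_ball : clear implicits.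

Definition l2_lipschitz_on (R : realType) (n : nat) (S : set 'rV[R]_n)
    (L : R) (f : 'rV[R]_n -> R) : Prop :=
  forall u v, S u -> S v -> `|f u - f v| <= L * l2norm (u - v).

Definition is_argmin_on (R : realType) (T : Type) (S : set T) (f : T -> R)
    (a : T) : Prop :=
  S a /\ forall b, S b -> f a <= f b.

Definition is_argmax_on (R : realType) (T : Type) (S : set T) (f : T -> R)
    (a : T) : Prop :=
  S a /\ forall b, S b -> f b <= f a.

(* Membership in [Lfun P 1] says that X is measurable and integrable, so that
   [fine 'E_P[X]] is the actual mean. *)
Definition sub_gaussian (disp : measure_display) (T : measurableType disp)
    (R : realType) (P : probability T R) (sigma : R) (X : T -> R) : Prop :=
  X \in Lfun P 1%E /\
  forall lambda : R,
    ('E_P[fun z => expR (lambda * (X z - fine 'E_P[X]))]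
       <= (expR (lambda ^+ 2 * sigma ^+ 2 / 2))%:E)%E.

Section product_power.
Context (disp : measure_display) (T : measurableType disp) (R : realType).

Definition tuple_cons (n : nat) (z : T * n.-tuple T) : n.+1.-tuple T :=
  [tuple of z.1 :: z.2].

Lemma measurable_tuple_cons (n : nat) :
  measurable_fun [set: T * n.-tuple T] (@tuple_cons n).
Proof. exact: measurable_cons. Qed.

HB.instance Definition _ (n : nat) :=
  isMeasurableFun.Build _ _ _ _ (@tuple_cons n) (@measurable_tuple_cons n).

(* The n-fold product measure on n-tuples, i.e. the law of an i.i.d. sample of
   size n drawn from P; see [iid_sample_box]. *)
Fixpoint iid_sample (P : probability T R) (n : nat) :
    probability (n.-tuple T) R :=
  match n with
  | 0 => \d_ ([tuple] : 0.-tuple T)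
  | m.+1 => distribution (P \x iid_sample P m)%E (@tuple_cons m)
  end.

Lemma iid_sample_box (P : probability T R) (n : nat) (A : 'I_n -> set T) :
  (forall i, measurable (A i)) ->
  iid_sample P n [set v | forall i, A i (tnth v i)]
    = (\prod_(i < n) P (A i))%E.
Proof.
elim: n A => [|n IHn] A mA.
  rewrite big_ord0 /= diracE mem_set//.
  by case.
have mB : measurable
    [set v : n.-tuple T | forall i, A (lift ord0 i) (tnth v i)].
  rewrite (_ : [set _ | _] = \big[setI/setT]_(i < n)
      ((fun v : n.-tuple T => tnth v i) @^-1` A (lift ord0 i))).
    apply: bigsetI_measurable => i _; rewrite -[X in measurable X]setTI.
    exact: measurable_tnth.
  apply/seteqP; split => [v Av|v].
    by elim/big_ind : _ => // i _; exact: Av.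
  by move=> + i; rewrite (bigD1 i)//= => -[].
rewrite big_ord_recl /= /distribution /pushforward /=.
rewrite -(IHn (fun i => A (lift ord0 i)))// -product_measure1E//.
congr (_ _); apply/seteqP; split => [[x v] /= Av|[x v] /= [Ax Av] i].
  split; first by have := Av ord0; rewrite tnth0.
  by move=> i; have := Av (lift ord0 i); rewrite tnthS.
have [j ->|->] := unliftP ord0 i; first by rewrite tnthS.
by rewrite tnth0.
Qed.

End product_power.

(* An example (x, y); x in R^D is a tuple, because tuples carry the product
   Borel sigma-algebra in the library. Labels range over all of R: a label set
   Y is imposed by requiring y in Y almost surely. *)
Notation example R D := (D.-tuple R * R)%type.

Section metric.
Context (R : realType) (D K : nat).
Variables (ell : 'I_K -> example R D -> 'rV[R]_D -> R) (Psi : 'rV[R]_K -> R).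

Definition phi (P : probability (example R D) R) (k : 'I_K)
    (theta : 'rV[R]_D) : R :=
  fine 'E_P[fun z => ell k z theta].

Definition metric (P : probability (example R D) R) (theta : 'rV[R]_D) : R :=
  Psi (\row_k phi P k theta).

Definition phi_hat (N : nat) (V : N.-tuple (example R D)) (k : 'I_K)
    (theta : 'rV[R]_D) : R :=
  N%:R^-1 * \sum_(i < N) ell k (tnth V i) theta.

Definition metric_hat (N : nat) (V : N.-tuple (example R D))
    (theta : 'rV[R]_D) : R :=
  Psi (\row_k phi_hat V k theta).

End metric.

Definition weighted_loss (R : realType) (D d : nat)
    (h : D.-tuple R -> 'rV[R]_D -> R) (L : R -> R -> R)
    (w : example R D -> 'rV[R]_d -> R) (T : seq (example R D))
    (alpha : 'rV[R]_d) (theta : 'rV[R]_D) : R :=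
  \sum_(z <- T) w z alpha * L (h z.1 theta) z.2.

(* Main.v *)
(** A maximal eps-separated subset of the unit ball, eps = 3 sigma / sqrt N <= 1,
    is an eps-cover with at most (1 + 2 / eps) ^ d <= (sqrt N / sigma) ^ d
    points.  By the Chernoff bound for sums of sub-Gaussian variables and a
    union bound over this set and the K losses, all the empirical means are
    within t = sigma / sqrt N * sqrt (d ln (N / sigma ^ 2) + 2 ln (2 K / delta))
    of the true ones with probability at least 1 - delta.  On that event,
    comparing alpha_star with the nearest candidate b costs
    LPsi * sqrt K * Lphi * eps, and replacing b by the empirical maximizer costs
    twice LPsi * sqrt K * t. *)
Require Import Defs.
From HB Require Import structures.
From mathcomp Require Import all_boot all_order all_algebra.
From mathcomp Require Import all_classical all_reals all_analysis.
From mathcomp Require Import measurable_realfun ring lra.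
Import Order.TTheory GRing.Theory Num.Theory.
Import numFieldNormedType.Exports.
Local Open Scope classical_set_scope.
Local Open Scope ring_scope.

(** * Euclidean norm on row vectors *)

Section l2norm_theory.
Context {R : realType} {n : nat}.
Implicit Types (u v : 'rV[R]_n).

Lemma l2norm_ge0 u : 0 <= l2norm u.
Proof. exact: sqrtr_ge0. Qed.

Lemma sqr_l2norm u : l2norm u ^+ 2 = \sum_(i < n) u ord0 i ^+ 2.
Proof. by rewrite sqr_sqrtr// sumr_ge0// => i _; exact: sqr_ge0. Qed.

Lemma coord_le_l2norm u i : `|u ord0 i| <= l2norm u.
Proof.
rewrite -sqrtr_sqr ler_wsqrtr// (bigD1 i)//= lerDl.
by rewrite sumr_ge0// => j _; exact: sqr_ge0.
Qed.

Lemma l2norm0_eq0 u : l2norm u = 0 -> u = 0.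
Proof.
move=> u0; apply/rowP => i; rewrite mxE; apply/normr0_eq0/le_anti.
by rewrite normr_ge0 -u0 coord_le_l2norm.
Qed.

Lemma l2norm0 : l2norm (0 : 'rV[R]_n) = 0.
Proof.
by rewrite /l2norm big1 ?sqrtr0// => i _; rewrite mxE expr0n.
Qed.

Lemma l2normZ (c : R) u : l2norm (c *: u) = `|c| * l2norm u.
Proof.
rewrite /l2norm -sqrtr_sqr -sqrtrM ?sqr_ge0//; congr Num.sqrt.
by rewrite mulr_sumr; apply: eq_bigr => i _; rewrite mxE exprMn.
Qed.

Lemma l2normN u : l2norm (- u) = l2norm u.
Proof. by rewrite -scaleN1r l2normZ normrN1 mul1r. Qed.

(** Cauchy-Schwarz: with [a], [b] the two norms and [s] the dot product, the sum of the squares (b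
    u_i - a v_i)^2 expands to 2 a b (a b - s). The factor 2 a b is then cancelled, so vanishing
    norms are treated first. *)
Lemma dot_le_l2norm u v :
  \sum_(i < n) u ord0 i * v ord0 i <= l2norm u * l2norm v.
Proof.
have [u0|u0] := eqVneq (l2norm u) 0.
  rewrite u0 mul0r (l2norm0_eq0 u u0) big1// => i _.
  by rewrite mxE mul0r.
have [v0|v0] := eqVneq (l2norm v) 0.
  rewrite v0 mulr0 (l2norm0_eq0 v v0) big1// => i _.
  by rewrite mxE mulr0.
have uv0 : 0 < l2norm u * l2norm v by rewrite mulr_gt0// lt0r l2norm_ge0 ?u0 ?v0.
set a := l2norm u in uv0 *; set b := l2norm v in uv0 *.
set s := \sum_(i < n) _.
have : 0 <= \sum_(i < n) (b * u ord0 i - a * v ord0 i) ^+ 2.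
  by rewrite sumr_ge0// => i _; exact: sqr_ge0.
suff -> : \sum_(i < n) (b * u ord0 i - a * v ord0 i) ^+ 2
    = 2 * (a * b) * (a * b - s).
  by rewrite pmulr_rge0 ?subr_ge0// mulr_gt0.
transitivity (b ^+ 2 * (\sum_(i < n) u ord0 i ^+ 2) - 2 * (a * b) * s
    + a ^+ 2 * (\sum_(i < n) v ord0 i ^+ 2)).
  rewrite /s !mulr_sumr -sumrB -big_split/=.
  by apply: eq_bigr => i _; ring.
by rewrite -!sqr_l2norm -/a -/b; ring.
Qed.

Lemma l2norm_triangle u v : l2norm (u + v) <= l2norm u + l2norm v.
Proof.
rewrite -ler_sqr ?nnegrE ?addr_ge0 ?l2norm_ge0// sqrrD !sqr_l2norm.
have -> : \sum_(i < n) (u + v) ord0 i ^+ 2 = \sum_(i < n) u ord0 i ^+ 2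
    + (\sum_(i < n) u ord0 i * v ord0 i) *+ 2 + \sum_(i < n) v ord0 i ^+ 2.
  rewrite -mulr_natl mulr_sumr -!big_split/=.
  by apply: eq_bigr => i _; rewrite mxE; ring.
by rewrite lerD2r lerD2l ler_wMn2r// dot_le_l2norm.
Qed.

Lemma l2norm_triangleB u v : l2norm (u - v) <= l2norm u + l2norm v.
Proof. by rewrite -[l2norm v]l2normN l2norm_triangle. Qed.

Lemma l2norm_le_sum u : l2norm u <= \sum_(i < n) `|u ord0 i|.
Proof.
have s0 : 0 <= \sum_(i < n) `|u ord0 i| by rewrite sumr_ge0.
rewrite -ler_sqr ?nnegrE ?l2norm_ge0// sqr_l2norm expr2 mulr_suml.
rewrite ler_sum// => i _; rewrite -real_normK ?num_real// expr2 ler_wpM2l//.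
by rewrite (bigD1 i)//= lerDl sumr_ge0.
Qed.

Lemma l2norm_le_sqrt u (c : R) : 0 <= c -> (forall i, `|u ord0 i| <= c) ->
  l2norm u <= Num.sqrt n%:R * c.
Proof.
move=> c0 uc; rewrite -[c in leRHS](ger0_norm c0) -sqrtr_sqr -sqrtrM//.
rewrite ler_wsqrtr// mulr_natl -[n in leRHS]card_ord -sumr_const.
rewrite ler_sum// => i _; rewrite -real_normK ?num_real//.
by rewrite ler_sqr ?nnegrE ?uc.
Qed.

End l2norm_theory.

(** * Packing and covering of the unit ball *)

Lemma bernoulli_ineq {R : realDomainType} (x : R) (k : nat) :
  0 <= x -> 1 + k%:R * x <= (1 + x) ^+ k.
Proof.
move=> x0; elim: k => [|k IHk]; first by rewrite mul0r addr0 expr0.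
rewrite exprSr.
apply: le_trans (ler_wpM2r _ IHk); last by lra.
rewrite -natr1; have : 0 <= k%:R * x * x by rewrite !mulr_ge0.
lra.
Qed.

(** If a / b exceeded 1, its powers would grow at least linearly by Bernoulli and overtake [C]. This
    removes a multiplicative constant from a bound that holds for all powers. *)
Lemma le_of_exprn_le {R : archiRealFieldType} (a b C : R) : 0 < b ->
  (forall k, a ^+ k <= C * b ^+ k) -> a <= b.
Proof.
move=> b0 H; rewrite leNgt; apply/negP => ab.
pose x := a / b - 1.
have x0 : 0 < x by rewrite /x subr_gt0 ltr_pdivlMr ?mul1r.
have Hx k : 1 + k%:R * x <= C.
  apply: le_trans (bernoulli_ineq x k (ltW x0)) _.
  by rewrite /x addrC subrK expr_div_n ler_pdivrMr ?exprn_gt0.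
have C0 : 0 <= C / x by rewrite divr_ge0 ?ltW// (lt_le_trans _ (Hx 0))// mul0r addr0.
have := Hx (Num.truncn (C / x)).+1.
have /andP[_] := Num.Theory.truncn_itv C0.
rewrite ltr_pdivrMr// => h1 h2; lra.
Qed.
(* Scaling an eps-separated family by 1 / (1 + eps / 2) makes the balls of
   radius rho^-1 around its points, rho = 1 + 2 / eps, disjoint and contained in
   the unit ball; nesting k copies yields m ^ k disjoint balls of radius
   rho^-k. *)
Lemma nested_packing {R : realType} (d m : nat) (eps : R)
    (a : 'I_m -> 'rV[R]_d) (k : nat) : 0 < eps ->
  (forall i, l2norm (a i) <= 1) ->
  (forall i j, i != j -> eps <= l2norm (a i - a j)) ->
  let eta := (1 + 2 / eps)^-1 in
  exists (T : finType) (f : T -> 'rV[R]_d),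
    [/\ #|T| = (m ^ k)%N, forall t, l2norm (f t) <= 1 - eta ^+ k
      & forall t t', t != t' -> 2 * eta ^+ k <= l2norm (f t - f t')].
Proof.
move=> eps0 a1 asep eta.
have rho0 : 0 < 1 + 2 / eps by rewrite addr_gt0// divr_gt0.
have eta0 : 0 < eta by rewrite invr_gt0.
(* This is 1 / (1 + eps / 2). The identity c + eta = 1 keeps the nested points at norm at most c +
   eta (1 - eta^k) = 1 - eta^(k+1), and c eps = 2 eta separates distinct copies. *)
pose c := 2 * eta / eps.
have c0 : 0 < c by rewrite divr_gt0// mulr_gt0.
have ceps : c * eps = 2 * eta by rewrite /c divfK// gt_eqF.
have ceta : c + eta = 1.
  rewrite /c /eta; field.
  by rewrite gt_eqF//= gt_eqF// addr_gt0.
elim: k => [|k [T [f [cardT f1 fsep]]]].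
  exists unit, (fun=> 0); split.
  - by rewrite card_unit.
  - by move=> _; rewrite expr0 subrr l2norm0.
  - by move=> [] [].
exists ('I_m * T)%type, (fun z => c *: a z.1 + eta *: f z.2); split.
- by rewrite card_prod card_ord cardT expnS.
- move=> [i t] /=; apply: le_trans (l2norm_triangle _ _) _.
  rewrite !l2normZ (gtr0_norm c0) (gtr0_norm eta0) exprS.
  have := ler_wpM2l (ltW c0) (a1 i); have := ler_wpM2l (ltW eta0) (f1 t).
  by rewrite mulrBr !mulr1; lra.
- move=> [i t] [j t'] /= neq.
  (* Within one copy the separation is that of [f] scaled by [eta]. Across copies the centres are at
     least 2 eta apart, and the two inner points take back at most 2 eta (1 - eta^k), which leaves 2
     eta^(k+1). *)
  have [ij|ij] := eqVneq i j.
    have tt' : t != t' by apply: contra neq => /eqP ->; rewrite ij.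
    rewrite ij addrAC opprD addrA subrr add0r addrC -scalerBr l2normZ.
    by rewrite gtr0_norm// exprS mulrCA ler_pM2l// fsep.
  have -> : c *: a i + eta *: f t - (c *: a j + eta *: f t')
      = c *: (a i - a j) - eta *: (f t' - f t).
    by rewrite !scalerBr !opprB opprD addrACA.
  set u := c *: _; set v := eta *: _.
  have uv : l2norm u <= l2norm (u - v) + l2norm v.
    by rewrite -{1}(subrK v u) l2norm_triangle.
  have uge : 2 * eta <= l2norm u.
    by rewrite l2normZ gtr0_norm// -ceps ler_pM2l// asep.
  have vle : l2norm v <= eta * (2 - 2 * eta ^+ k).
    rewrite l2normZ gtr0_norm// ler_pM2l//.
    apply: le_trans (l2norm_triangleB _ _) _.
    by have := f1 t; have := f1 t'; lra.
  by rewrite exprS; lra.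
Qed.

(** Pigeonhole on a grid of mesh 1 / n: points in the same cell differ by at most 1 / n in each
    coordinate, hence by at most d / n < s in norm. The count is crude by a constant factor, which
    [packing_bound] eliminates. *)
Lemma grid_packing_bound {R : realType} (d n : nat) (s : R) (T : finType)
    (f : T -> 'rV[R]_d) : (0 < n)%N -> d%:R < s * n%:R ->
  (forall t, l2norm (f t) <= 1) ->
  (forall t t', t != t' -> s <= l2norm (f t - f t')) ->
  (#|T| <= (n.*2).+1 ^ d)%N.
Proof.
move=> n0 dsn f1 fsep.
have n0R : 0 < n%:R :> R by rewrite ltr0n.
(* The shift by 1 moves the coordinates from [-1, 1] to [0, 2 n], where truncation acts as the floor
   and takes 2 n + 1 values. *)
pose x t i : R := (f t ord0 i + 1) * n%:R.
have fi t i : -1 <= f t ord0 i <= 1.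
  by rewrite -ler_norml (le_trans (coord_le_l2norm _ _)).
have x0 t i : 0 <= x t i.
  by rewrite mulr_ge0// -lerBlDr sub0r; case/andP: (fi t i).
have xn t i : (Num.truncn (x t i) < (n.*2).+1)%N.
  rewrite Num.Theory.truncn_lt_nat// (@le_lt_trans _ _ (n.*2)%:R) ?ltr_nat//.
  rewrite -mul2n natrM ler_pM2r//.
  by have /andP[_] := fi t i; lra.
pose g t : {ffun 'I_d -> 'I_(n.*2).+1} := [ffun i => Ordinal (xn t i)].
suff ginj : injective g by have := leq_card g ginj; rewrite card_ffun !card_ord.
move=> t t' gtt'; apply/eqP; apply: contraT => /fsep.
suff : l2norm (f t - f t') < s by rewrite ltNge => /negbTE ->.
rewrite (le_lt_trans (l2norm_le_sum _))// -(ltr_pM2r n0R).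
apply: le_lt_trans dsn; rewrite mulr_suml -[d in leRHS]card_ord -sumr_const.
apply: ler_sum => i _; rewrite !mxE -[n%:R]gtr0_norm// -normrM.
have -> : (f t ord0 i - f t' ord0 i) * n%:R = x t i - x t' i by rewrite /x; ring.
have /andP[] := Num.Theory.truncn_itv (x0 t i).
have /andP[] := Num.Theory.truncn_itv (x0 t' i).
have -> : Num.truncn (x t i) = Num.truncn (x t' i).
  by have /(congr1 val) := congr1 (fun h : {ffun _ -> _} => h i) gtt'; rewrite !ffunE.
rewrite -!natr1 => *; rewrite ler_norml; apply/andP; split; lra.
Qed.

(** The usual volume comparison, obtained without a volume: [nested_packing] yields m^k separated
    points, the grid count gives m^k <= C (rho^d)^k with [C] independent of [k], and letting [k]
    grow removes [C]. *)
Lemma packing_bound {R : realType} (d m : nat) (eps : R)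
    (a : 'I_m -> 'rV[R]_d) : 0 < eps ->
  (forall i, l2norm (a i) <= 1) ->
  (forall i j, i != j -> eps <= l2norm (a i - a j)) ->
  m%:R <= (1 + 2 / eps) ^+ d.
Proof.
move=> eps0 a1 asep; set rho := 1 + 2 / eps.
have rho1 : 1 <= rho by rewrite lerDl divr_ge0// ltW.
have rho0 : 0 < rho by rewrite (lt_le_trans ltr01).
(* The constant comes from n <= d rho^k + 1 for the [n] chosen below, so that 2 n + 1 <= 2 d rho^k +
   3 <= (2 d + 3) rho^k. *)
apply: (@le_of_exprn_le _ _ _ ((2 * d%:R + 3) ^+ d)); first exact: exprn_gt0.
move=> k; have [T [f [cardT f1 fsep]]] := nested_packing d m eps a k eps0 a1 asep.
rewrite -/rho in f1 fsep.
have rk1 : 1 <= rho ^+ k by rewrite exprn_ege1.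
have rk0 : 0 < rho ^+ k by rewrite exprn_gt0.
have drk0 : 0 <= d%:R * rho ^+ k by rewrite mulr_ge0// ltW.
pose n := (Num.truncn (d%:R * rho ^+ k)).+1.
have /andP[nle ngt] := Num.Theory.truncn_itv drk0.
have Tn : (#|T| <= (n.*2).+1 ^ d)%N.
  apply: (@grid_packing_bound _ _ _ (2 * rho^-1 ^+ k) _ f) => //.
    rewrite exprVn mulrAC ltr_pdivlMr// (lt_le_trans ngt)//.
    by rewrite ler_peMl// ler1n.
  by move=> t; rewrite (le_trans (f1 t))// gerBl exprn_ge0// invr_ge0 ltW.
rewrite -natrX -cardT (@le_trans _ _ (((n.*2).+1 ^ d)%N%:R))// ?ler_nat//.
rewrite natrX -!exprM mulnC exprM -exprMn lerXn2r// ?nnegrE//.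
  by rewrite mulr_ge0// ?addr_ge0// ?mulr_ge0// ltW.
have nE : (Num.truncn (d%:R * rho ^+ k))%:R + 1 = n%:R :> R by exact: natr1.
rewrite -natr1 -mul2n natrM -nE [leRHS]mulrDl -mulrA; lra.
Qed.

(** [packing_bound] caps the length of separated sequences, so one of maximal length exists; a point
    that it left uncovered could be prepended to it. *)
Lemma unit_ball_cover {R : realType} (d : nat) (eps : R) : 0 < eps ->
  exists s : seq 'rV[R]_d,
    [/\ (size s)%:R <= (1 + 2 / eps) ^+ d,
        forall a, a \in s -> l2norm a <= 1
      & forall a, l2norm a <= 1 -> exists2 b, b \in s & l2norm (a - b) <= eps].
Proof.
move=> eps0.
(* The strict inequality is exactly the negation of being covered within [eps]. *)
pose sep (s : seq 'rV[R]_d) := all (fun a => l2norm a <= 1) s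
  && pairwise (fun a b => eps < l2norm (a - b)) s.
have sep_bound s : sep s -> (size s)%:R <= (1 + 2 / eps) ^+ d.
  case/andP=> /allP s1 /(pairwiseP 0) sepS.
  apply: (packing_bound d (size s) eps (fun i => nth 0 s i)) => //.
    by move=> i; rewrite s1// mem_nth.
  move=> i j; wlog ij : i j / (i < j)%N => [hw neq|_].
    have := neq; rewrite -val_eqE neq_ltn => /orP[?|?]; first exact: hw.
    by rewrite -l2normN opprB hw// eq_sym.
  by rewrite ltW// sepS// inE.
pose p k := `[< exists2 s, sep s & size s = k >].
have exp : exists k, p k by exists 0%N; apply/asboolP; exists [::].
have bndp k : p k -> (k <= Num.truncn ((1 + 2 / eps) ^+ d))%N.
  move=> /asboolP[s ss <-]; rewrite Num.Theory.truncn_ge_nat ?sep_bound//.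
  by rewrite exprn_ge0// addr_ge0// divr_ge0// ltW.
have [k /asboolP[s ss sk] kmax] := ex_maxnP exp bndp.
exists s; split => [||a a1].
- exact: sep_bound.
- by have /andP[/allP s1 _] := ss.
- apply: contrapT => nb.
  suff : p (size s).+1 by move/kmax; rewrite sk ltnn.
  apply/asboolP; exists (a :: s) => //.
  have /andP[s1 ss2] := ss.
  rewrite /sep /= a1 s1 ss2 /= andbT; apply/allP => b bs /=.
  by rewrite ltNge; apply/negP => abe; apply: nb; exists b.
Qed.

(** * Measurability of Lipschitz functions of several measurable functions *)

(** [f] is the infimum, over rational rows q, of f(q) plus [L] times the l1 distance to q. A strict
    sublevel set is therefore a countable union of measurable sets. *)
Lemma measurable_lipschitz_comp {disp} {T : measurableType disp} {R : realType}
    (K : nat) (L : R) (f : 'rV[R]_K -> R) (F : 'I_K -> T -> R) :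
  0 <= L -> l2_lipschitz_on setT L f ->
  (forall k, measurable_fun setT (F k)) ->
  measurable_fun setT (fun x => f (\row_k F k x)).
Proof.
move=> L0 fL mF.
have fL1 u v : f u <= f v + L * \sum_(k < K) `|u ord0 k - v ord0 k|.
  have := fL u v Logic.I Logic.I.
  rewrite -lerBlDl => /(le_trans (ler_norm _))/le_trans; apply.
  rewrite ler_wpM2l// (le_trans (l2norm_le_sum _))//.
  by apply: ler_sum => k _; rewrite !mxE.
pose qr (q : 'rV[rat]_K) : 'rV[R]_K := \row_k ratr (q ord0 k).
pose g q x := f (qr q) + L * \sum_(k < K) `|F k x - qr q ord0 k|.
apply: (measurability _ (measurable_realfun.RGenInftyO.measurableE R)) => _ [_ [c ->] <-].
rewrite setTI.
have -> : (fun x => f (\row_k F k x)) @^-1` `]-oo, c[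
    = \bigcup_(q : 'rV[rat]_K) [set x | g q x < c].
  apply/seteqP; split => [x|x [q _]] /=; rewrite in_itv/=; last first.
    apply: le_lt_trans; apply: le_trans (fL1 _ (qr q)) _.
    by rewrite lerD2l ler_wpM2l// ler_sum// => k _; rewrite mxE.
  (* Passing to a rational row within [e] in each coordinate costs at most L K e in the value of [f]
     and L K e in the penalty. The + 1 keeps the denominator positive and leaves a slack of [e]. *)
  move=> fc; pose e := (c - f (\row_k F k x)) / (2 * L * K%:R + 1).
  have den0 : 0 < 2 * L * K%:R + 1 by rewrite ltr_wpDl// !mulr_ge0.
  have e0 : 0 < e by rewrite divr_gt0// subr_gt0.
  have hq k : exists q : rat, `|ratr q - F k x| <= e.
    have /rat_in_itvoo[q] : F k x < F k x + e by rewrite ltrDl.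
    rewrite in_itv/= => /andP[q1 q2]; exists q.
    by rewrite gtr0_norm ?subr_gt0// lerBlDl ltW.
  have [q Hq] := choice hq.
  exists (\row_k q k) => //=; rewrite /g.
  have qu k : `|qr (\row_k q k) ord0 k - F k x| <= e by rewrite !mxE.
  have su : \sum_(k < K) `|qr (\row_k q k) ord0 k - F k x| <= K%:R * e.
    by rewrite -[K in leRHS]card_ord mulr_natl -sumr_const ler_sum.
  have -> : \sum_(k < K) `|F k x - qr (\row_k q k) ord0 k|
     = \sum_(k < K) `|qr (\row_k q k) ord0 k - F k x|.
    by apply: eq_bigr => k _; rewrite distrC.
  have := fL1 (qr (\row_k q k)) (\row_k F k x).
  have -> : \sum_(k < K) `|qr (\row_k q k) ord0 k - (\row_k F k x) ord0 k|
     = \sum_(k < K) `|qr (\row_k q k) ord0 k - F k x|.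
    by apply: eq_bigr => k _; rewrite [(\row_k F k x) _ _]mxE.
  move: su; set s := \sum_(k < K) _ => su fq.
  have Ls : L * s <= L * (K%:R * e) by rewrite ler_wpM2l.
  have : e * (2 * L * K%:R + 1) = c - f (\row_k F k x).
    by rewrite /e divfK// gt_eqF.
  have -> : e * (2 * L * K%:R + 1) = 2 * (L * (K%:R * e)) + e by ring.
  lra.
apply: countable_bigcupT_measurable => [|q]; first exact: countableP.
have mg : measurable_fun setT (g q).
  apply: measurable_funD => //; apply: measurable_funM => //.
  apply: measurable_sum => k; apply: measurableT_comp => //.
  exact: measurable_funB.
have -> : [set x | g q x < c] = g q @^-1` `]-oo, c[.
  by apply/seteqP; split => x; rewrite /= in_itv.
by rewrite -[X in measurable X]setTI; exact: mg.
Qed.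

(** * Concentration of empirical means *)

Lemma lee_pXn2r {R : realDomainType} (x y : \bar R) (n : nat) :
  (0 <= x -> x <= y -> x ^+ n <= y ^+ n)%E.
Proof.
move=> x0 xy; elim: n => [|n IHn]; first by rewrite !expe0.
by rewrite !expeS lee_pmul// expe_ge0.
Qed.

Section concentration.
Context {disp : measure_display} {T : measurableType disp} {R : realType}.
Variable P : probability T R.

Lemma measurable_tnth_sum n (g : T -> R) : measurable_fun setT g ->
  measurable_fun setT (fun v : n.-tuple T => \sum_(i < n) g (tnth v i)).
Proof.
move=> mg; apply: measurable_sum => i.
by apply: measurableT_comp => //; exact: measurable_tnth.
Qed.

(** Independence turns the exponential of a sum into a product of expectations: each induction step
    splits off the head of the tuple and applies Tonelli. The equality lives in the extended reals,
    so infinite expectations are covered. *)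
Lemma iid_sample_mgf n (g : T -> R) : measurable_fun setT g ->
  ('E_(iid_sample P n)[fun v => expR (\sum_(i < n) g (tnth v i))]
    = 'E_P[fun x => expR (g x)] ^+ n)%E.
Proof.
move=> mg; rewrite unlock.
have mS m : measurable_fun setT
    (fun v : m.-tuple T => (expR (\sum_(i < m) g (tnth v i)))%:E).
  apply/measurable_EFinP; apply: measurableT_comp => //.
  exact: measurable_tnth_sum.
elim: n => [|n IHn].
  rewrite /= integral_dirac//=; last exact: (mS 0).
  by rewrite diracT mul1e big_ord0 expR0.
have S0 m (v : m.-tuple T) : (0 <= (expR (\sum_(i < m) g (tnth v i)))%:E)%E.
  by rewrite lee_fin expR_ge0.
rewrite /= (ge0_integral_distribution _ (mS n.+1) (@S0 _)).
have fE : (fun v : n.+1.-tuple T => (expR (\sum_(i < n.+1) g (tnth v i)))%:E)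
      \o @tuple_cons _ T n
    = fun z => ((expR (g z.1))%:E * (expR (\sum_(i < n) g (tnth z.2 i)))%:E)%E.
  apply/funext => -[x v] /=; rewrite -EFinM -expRD big_ord_recl tnth0.
  by congr (expR (_ + _))%:E; apply: eq_bigr => i _; rewrite tnthS.
have mge : measurable_fun setT (fun x => (expR (g x))%:E).
  by apply/measurable_EFinP; exact: measurableT_comp.
have g0 x : (0 <= (expR (g x))%:E)%E by rewrite lee_fin expR_ge0.
rewrite fE fubini_tonelli1/=; first last.
- by move=> z; rewrite mule_ge0.
- apply: emeasurable_funM.
    exact: (measurableT_comp mge measurable_fst).
  exact: (measurableT_comp (mS n) measurable_snd).
rewrite /fubini_F /=.
under eq_integral => x _.
  rewrite ge0_integralZl//; last exact: mS.
  rewrite IHn; over.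
rewrite (ge0_integralZr _ measurableT mge)//; last first.
  by rewrite expe_ge0// integral_ge0.
by rewrite -[LHS]expeS.
Qed.

Lemma chernoff_sum n (g : T -> R) (r a : R) : measurable_fun setT g ->
  0 < r ->
  (iid_sample P n [set v | a <= \sum_(i < n) g (tnth v i)]%R
    <= 'E_P[fun x => expR (r * g x)] ^+ n * (expR (- (r * a)))%:E)%E.
Proof.
move=> mg r0.
pose S (v : n.-tuple T) := \sum_(i < n) g (tnth v i).
have mS : measurable_fun setT S by exact: measurable_tnth_sum.
pose X : {mfun n.-tuple T >-> R} := HB.pack S (isMeasurableFun.Build _ _ _ _ S mS).
have := @chernoff _ _ _ (iid_sample P n) X r a r0.
rewrite -(iid_sample_mgf n (fun x => r * g x)); last exact: measurable_funM.
suff -> : ('M_(iid_sample P n) X r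
   = 'E_(iid_sample P n)[fun v => expR (\sum_(i < n) r * g (tnth v i))])%E by [].
rewrite /mmt_gen_fun; congr expectation; apply/funext => v /=.
by rewrite /S mulr_suml; congr expR; apply: eq_bigr => i _; rewrite mulrC.
Qed.

(** One-sided Chernoff bound; [X] plays the role of an already centred variable. *)
Lemma sub_gaussian_sum_tail n (sigma t : R) (X : T -> R) :
  0 < sigma -> 0 < t -> measurable_fun setT X ->
  (forall lambda, 'E_P[fun z => expR (lambda * X z)]
     <= (expR (lambda ^+ 2 * sigma ^+ 2 / 2))%:E)%E ->
  (iid_sample P n [set v | n%:R * t <= \sum_(i < n) X (tnth v i)]%R
    <= (expR (- (n%:R * t ^+ 2 / (2 * sigma ^+ 2))))%:E)%E.
Proof.
move=> sigma0 t0 mX Xsg.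
have s20 : 0 < sigma ^+ 2 by rewrite exprn_gt0.
(* The minimizer of the Chernoff exponent n (r^2 sigma^2 / 2 - r t). *)
pose r := t / sigma ^+ 2.
have r0 : 0 < r by rewrite divr_gt0.
apply: le_trans (chernoff_sum n X r (n%:R * t) mX r0) _.
have E0 : (0 <= 'E_P[fun x => expR (r * X x)])%E.
  by rewrite expectation_ge0// => x; rewrite expR_ge0.
have En := lee_pXn2r _ _ n E0 (Xsg r).
apply: (@le_trans _ _ ((expR (r ^+ 2 * sigma ^+ 2 / 2))%:E ^+ n
    * (expR (- (r * (n%:R * t))))%:E)%E).
  by rewrite lee_wpmul2r ?lee_fin ?expR_ge0.
rewrite -EFin_expe -EFinM -expRM_natl -expRD lee_fin ler_expR.
rewrite le_eqVlt; apply/orP; left; apply/eqP.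
by rewrite /r; field; rewrite gt_eqF.
Qed.

(** The sub-Gaussian bound is even in [lambda], so the one-sided tail applies to the centred
    variable and to its opposite; their union gives the factor 2. *)
Lemma sub_gaussian_mean_tail n (sigma t : R) (X : T -> R) :
  (0 < n)%N -> 0 < sigma -> 0 < t -> sub_gaussian P sigma X ->
  let E := [set v : n.-tuple T |
      t <= `|n%:R^-1 * (\sum_(i < n) X (tnth v i)) - fine 'E_P[X]%E|] in
  measurable E /\
  (iid_sample P n E
     <= (2 * expR (- (n%:R * t ^+ 2 / (2 * sigma ^+ 2))))%:E)%E.
Proof.
move=> n0 sigma0 t0 [XL Xsg] E.
have mX : measurable_fun setT X.
  by move: XL; rewrite inE => /andP[/[!inE]/=].
have n0R : 0 < n%:R :> R by rewrite ltr0n.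
set mu := fine _ in Xsg E *.
pose X1 z := X z - mu; pose X2 z := - X1 z.
have mX1 : measurable_fun setT X1 by exact: measurable_funB.
have mX2 : measurable_fun setT X2 by exact: measurableT_comp.
have X2sg lambda : ('E_P[fun z => expR (lambda * X2 z)]
     <= (expR (lambda ^+ 2 * sigma ^+ 2 / 2))%:E)%E.
  rewrite -(sqrrN lambda); have := Xsg (- lambda).
  by under [in X in X -> _]eq_fun do rewrite mulNr -mulrN.
pose E' (Y : T -> R) :=
  [set v : n.-tuple T | n%:R * t <= \sum_(i < n) Y (tnth v i)].
have mE' Y : measurable_fun setT Y -> measurable (E' Y).
  move=> mY; rewrite -[E' Y]setTI.
  have -> : E' Y = (fun v : n.-tuple T => \sum_(i < n) Y (tnth v i))
      @^-1` `[n%:R * t, +oo[.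
    by apply/seteqP; split => v; rewrite /= in_itv/= andbT.
  exact: measurable_tnth_sum.
have EE : E = E' X1 `|` E' X2.
  apply/funext => v; apply/propext; rewrite /E /E' /=.
  have -> : n%:R^-1 * (\sum_(i < n) X (tnth v i)) - mu
      = n%:R^-1 * \sum_(i < n) X1 (tnth v i).
    rewrite /X1 sumrB sumr_const card_ord mulrBr -[mu *+ n]mulr_natl.
    by rewrite mulKf// gt_eqF.
  rewrite /X2 sumrN normrM (@ger0_norm _ n%:R^-1) ?invr_ge0// ler_pdivlMl//.
  by rewrite ler_normr; split => /orP.
have mE1 := mE' _ mX1; have mE2 := mE' _ mX2.
rewrite EE; split; first exact: measurableU.
apply: le_trans (measureU2 _ mE1 mE2) _.
rewrite [2 * _]mulrDl mul1r EFinD; apply: leeD.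
  exact: sub_gaussian_sum_tail.
exact: sub_gaussian_sum_tail.
Qed.

End concentration.

(** * Maximizers, union bound and Lipschitz estimates *)

Lemma measurable_is_argmax {disp} {T : measurableType disp} {R : realType}
    {I : Type} (A : set I) (F : I -> T -> R) (a : I) : finite_set A ->
  (forall i, measurable_fun setT (F i)) ->
  measurable [set x | is_argmax_on A (F ^~ x) a].
Proof.
move=> finA mF.
have [Aa|nAa] := pselect (A a); last first.
  rewrite [X in measurable X](_ : _ = set0)//.
  by apply/seteqP; split => x // [/nAa].
have -> : [set x | is_argmax_on A (F ^~ x) a]
    = \bigcap_(b in A) [set x | F b x <= F a x].
  by apply/seteqP; split => x; [case|split].
apply: fin_bigcap_measurable => // b _.
have -> : [set x | F b x <= F a x] = (fun x => F b x <= F a x) @^-1` [set true].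
  by [].
by rewrite -[X in measurable X]setTI; exact: measurable_fun_ler.
Qed.

Lemma measure_bigsetU_le {disp} {T : measurableType disp} {R : realType}
    (mu : {measure set T -> \bar R}) {I : Type} (r : seq I) (A : I -> set T)
    (c : R) : (forall i, measurable (A i)) ->
  (forall i, (mu (A i) <= c%:E)%E) ->
  (mu (\big[setU/set0]_(i <- r) A i) <= ((size r)%:R * c)%:E)%E.
Proof.
move=> mA Ac; elim: r => [|i r IHr]; first by rewrite big_nil measure0 mul0r.
rewrite big_cons /= -nat1r mulrDl mul1r EFinD.
apply: le_trans (measureU2 _ (mA i) (bigsetU_measurable _ _)) (leeD (Ac i) IHr).
by move=> *; exact: mA.
Qed.

(** The origin and the first basis vector are at distance 1, so [L] bounds an absolute value. The
    signs of [LPsi] and [Lphi] are derived from this. *)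
Lemma l2_lipschitz_const_ge0 {R : realType} (n : nat) (S : set 'rV[R]_n) (L : R)
    (f : 'rV[R]_n -> R) : (0 < n)%N -> unit_ball R n `<=` S ->
  l2_lipschitz_on S L f -> 0 <= L.
Proof.
move=> n0 ballS fL; pose u : 'rV[R]_n := \row_j (j == Ordinal n0)%:R.
have u1 : l2norm u = 1.
  rewrite /l2norm (bigD1 (Ordinal n0))//= big1 ?addr0 ?mxE ?eqxx ?expr1n ?sqrtr1//.
  by move=> j /negbTE jn; rewrite mxE jn expr0n.
have Su : S u by apply: ballS; rewrite /unit_ball /= u1.
have S0 : S 0 by apply: ballS; rewrite /unit_ball /= l2norm0.
by have := le_trans (normr_ge0 _) (fL u 0 Su S0); rewrite subr0 u1 mulr1.
Qed.

(** Source of the factor sqrt K: a deviation [c] in each of the [K] coordinates has Euclidean norm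
    at most sqrt K times [c]. *)
Lemma l2_lipschitz_row {R : realType} (K : nat) (L c : R) (f : 'rV[R]_K -> R)
    (u v : 'I_K -> R) : 0 <= L -> 0 <= c -> l2_lipschitz_on setT L f ->
  (forall k, `|u k - v k| <= c) ->
  f (\row_k u k) - f (\row_k v k) <= L * (Num.sqrt K%:R * c).
Proof.
move=> L0 c0 fL uv; apply: le_trans (ler_norm _) _.
apply: le_trans (fL _ _ Logic.I Logic.I) _; rewrite ler_wpM2l//.
by apply: l2norm_le_sqrt => // k; rewrite !mxE.
Qed.

(** With y = sqrt N / sigma, the choice of [t] makes the exponential equal to y^(-d) delta / (2 K):
    the first factor absorbs the [m] candidates, the second the [K] losses and the two tails. *)
Lemma union_bound_budget {R : realType} (d K N : nat) (sigma delta m t : R) :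
  0 < sigma -> (0 < K)%N -> (0 < N)%N -> 0 < delta ->
  0 <= d%:R * ln (N%:R / sigma ^+ 2) + 2 * ln (2 * K%:R / delta) ->
  m <= (Num.sqrt N%:R / sigma) ^+ d ->
  t = sigma / Num.sqrt N%:R * Num.sqrt
        (d%:R * ln (N%:R / sigma ^+ 2) + 2 * ln (2 * K%:R / delta)) ->
  m * K%:R * (2 * expR (- (N%:R * t ^+ 2 / (2 * sigma ^+ 2)))) <= delta.
Proof.
move=> sigma0 K0 N0 delta0; set E := _ + _ => E0 my ->.
have K0R : 0 < K%:R :> R by rewrite ltr0n.
have N0R : 0 < N%:R :> R by rewrite ltr0n.
have sN0 : 0 < Num.sqrt N%:R :> R by rewrite sqrtr_gt0.
pose y : R := Num.sqrt N%:R / sigma.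
have y0 : 0 < y by rewrite divr_gt0.
have lny : ln (N%:R / sigma ^+ 2) = 2 * ln y.
  rewrite -[X in X / _]sqr_sqrtr ?ltW// -expr_div_n -/y lnXn//.
  by rewrite mulr_natl.
have -> : N%:R * (sigma / Num.sqrt N%:R * Num.sqrt E) ^+ 2 / (2 * sigma ^+ 2)
    = d%:R * ln y + ln (2 * K%:R / delta).
  rewrite exprMn expr_div_n (sqr_sqrtr E0) (sqr_sqrtr (ltW N0R)).
  rewrite /E lny; field.
  by rewrite !gt_eqF.
rewrite opprD expRD !expRN expRM_natl !lnK ?posrE ?divr_gt0 ?mulr_gt0//.
have yd0 : 0 < y ^+ d by rewrite exprn_gt0.
have -> : m * K%:R * (2 * ((y ^+ d)^-1 / (2 * K%:R / delta))) = m / y ^+ d * delta.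
  by field; rewrite !gt_eqF.
by rewrite (ler_piMl (ltW delta0))// ler_pdivrMr// mul1r.
Qed.

(** * Regret bound for the search over the cover *)

Theorem theorem2 (R : realType) (d K N : nat) (sigma : R)
    (hd : (1 <= d)%N) (hK : (1 <= K)%N) (hsigma : 0 < sigma)
    (hN : 9 * sigma ^+ 2 * K%:R <= N%:R) :
  (* the candidate set is fixed before the learning problem *)
  exists A : set 'rV[R]_d,
    [/\ finite_set A,
        A `<=` unit_ball R d,
        (forall a, unit_ball R d a ->
           exists2 b, A b & l2norm (a - b) <= 3 * sigma / Num.sqrt N%:R)
      & forall (D : nat) (Y : set R)
          (P : probability (example R D) R)
          (ell : 'I_K -> example R D -> 'rV[R]_D -> R)
          (Psi : 'rV[R]_K -> R)
          (h : D.-tuple R -> 'rV[R]_D -> R) (L : R -> R -> R)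
          (w : example R D -> 'rV[R]_d -> R) (T : seq (example R D))
          (theta_hat : 'rV[R]_d -> 'rV[R]_D)
          (alpha_star : 'rV[R]_d)
          (LPsi Lphi delta : R),
        0 < delta < 1 ->
        (* labels lie in Y *)
        {ae P, forall z, Y z.2} ->
        (forall z, z \in T -> Y z.2) ->
        (forall k z theta, Y z.2 -> 0 <= ell k z theta) ->
        (* example-weighted training *)
        (forall z alpha, Y z.2 -> unit_ball R d alpha -> 0 <= w z alpha) ->
        (forall alpha, unit_ball R d alpha ->
           is_argmin_on setT (weighted_loss h L w T alpha)
             (theta_hat alpha)) ->
        is_argmax_on (unit_ball R d)
          (fun alpha => metric ell Psi P (theta_hat alpha)) alpha_star ->
        (* (A) *)
        (forall k theta, sub_gaussian P sigma (fun z => ell k z theta)) ->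
        (* (B) *)
        l2_lipschitz_on setT LPsi Psi ->
        (* (C) *)
        (forall k, l2_lipschitz_on (unit_ball R d) Lphi
           (fun alpha => phi ell P k (theta_hat alpha))) ->
        let good : set (N.-tuple (example R D)) :=
          [set V | forall alpha_hat : 'rV[R]_d,
             is_argmax_on A (fun a => metric_hat ell Psi V (theta_hat a))
               alpha_hat ->
             metric ell Psi P (theta_hat alpha_star)
               - metric ell Psi P (theta_hat alpha_hat)
             <= sigma * LPsi * Num.sqrt K%:R / Num.sqrt N%:R
                * (Num.sqrt (4 * d%:R * ln (N%:R / sigma ^+ 2)
                             + 8 * ln (2 * K%:R / delta))
                   + 3 * Lphi)] in
        measurable good /\ ((1 - delta)%:E <= iid_sample P N good)%E].

Proof.
have N0R : 0 < N%:R :> R.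
  by apply: lt_le_trans hN; rewrite !mulr_gt0 ?exprn_gt0 ?ltr0n.
have N0 : (0 < N)%N by rewrite -(ltr0n R).
have sN0 : 0 < Num.sqrt N%:R :> R by rewrite sqrtr_gt0.
have K1R : 1 <= K%:R :> R by rewrite ler1n.
pose eps := 3 * sigma / Num.sqrt N%:R.
have eps0 : 0 < eps by rewrite divr_gt0// mulr_gt0.
have sN3 : 3 * sigma <= Num.sqrt N%:R.
  have s3 : 0 <= 3 * sigma by rewrite mulr_ge0// ltW.
  rewrite -ler_sqr ?nnegrE ?sqrtr_ge0// (sqr_sqrtr (ltW N0R)).
  apply: le_trans hN; rewrite exprMn.
  have s2 : 0 <= sigma ^+ 2 by exact: sqr_ge0.
  by have := ler_wpM2l s2 K1R; lra.
have [s [size_s s1 s_cover]] := unit_ball_cover d eps eps0.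
exists [set` s]; split => //.
move=> D Y P ell Psi h L w T theta_hat alpha_star LPsi Lphi delta.
move=> /andP[delta0 delta1] _ _ _ _ _ [star1 _] sgA lipPsi lipPhi good.
have LPsi0 : 0 <= LPsi by exact: (l2_lipschitz_const_ge0 _ _ _ _ hK _ lipPsi).
have Lphi0 : 0 <= Lphi.
  exact: (l2_lipschitz_const_ge0 _ _ _ _ hd _ (lipPhi (Ordinal hK))).
have mell k theta : measurable_fun setT (fun z => ell k z theta).
  by have [+ _] := sgA k theta; rewrite inE => /andP[/[!inE]].
pose Mhat a (V : N.-tuple (example R D)) := metric_hat ell Psi V (theta_hat a).
have mMhat a : measurable_fun setT (Mhat a).
  apply: (measurable_lipschitz_comp _ _ _
    (fun k V => phi_hat ell V k (theta_hat a)) LPsi0 lipPsi) => k.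
  apply: measurable_funM => //.
  exact: (measurable_tnth_sum _ (fun z => ell k z (theta_hat a)) (mell _ _)).
pose E := d%:R * ln (N%:R / sigma ^+ 2) + 2 * ln (2 * K%:R / delta).
(* Both logarithms have arguments above 1, since N / sigma^2 >= 9 and 2 K / delta > 1. Strict
   positivity gives t > 0, as the tail bound requires. *)
have E0 : 0 < E.
  rewrite ltr_pwDl//.
    rewrite mulr_gt0 ?ltr0n// ln_gt0// ltr_pdivlMr ?exprn_gt0// mul1r.
    apply: lt_le_trans hN; have : 0 < sigma ^+ 2 by rewrite exprn_gt0.
    move=> s2; have := ler_wpM2l (ltW s2) K1R; lra.
  rewrite mulr_ge0// ln_ge0// ler_pdivlMr// mul1r; lra.
pose t := sigma / Num.sqrt N%:R * Num.sqrt E.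
have t0 : 0 < t by rewrite mulr_gt0 ?divr_gt0// sqrtr_gt0.
pose bad (i : 'rV[R]_d * 'I_K) := [set V : N.-tuple (example R D) |
  t <= `|phi_hat ell V i.2 (theta_hat i.1) - phi ell P i.2 (theta_hat i.1)|].
have tail i := sub_gaussian_mean_tail P N sigma t _ N0 hsigma t0
  (sgA i.2 (theta_hat i.1)).
pose r := [seq (a, k) | a <- s, k <- enum 'I_K].
pose B := \big[setU/set0]_(i <- r) bad i.
have mB : measurable B by apply: bigsetU_measurable => i _; case: (tail i).
have PB : (iid_sample P N B <= delta%:E)%E.
  apply: le_trans (measure_bigsetU_le _ _ _ _ _ _) _ => [i|i|].
  - by case: (tail i).
  - by case: (tail i) => _; exact.
  rewrite size_allpairs size_enum_ord natrM lee_fin.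
  apply: (union_bound_budget d _ _ _ _ _ _ hsigma hK N0 delta0 (ltW E0)) => //.
  apply: le_trans size_s _; apply: lerXn2r.
  - by rewrite nnegrE addr_ge0// divr_ge0// ltW.
  - by rewrite nnegrE divr_ge0// ltW.
  rewrite /eps.
  have -> : 2 / (3 * sigma / Num.sqrt N%:R) = 2 / 3 * (Num.sqrt N%:R / sigma).
    by field; rewrite !gt_eqF.
  (* With y = sqrt N / sigma, the required 1 + 2 y / 3 <= y amounts to y >= 3. *)
  have : 3 <= Num.sqrt N%:R / sigma by rewrite ler_pdivlMr.
  lra.
have mgood : measurable good.
  pose concl a := metric ell Psi P (theta_hat alpha_star)
    - metric ell Psi P (theta_hat a) <= sigma * LPsi * Num.sqrt K%:R
      / Num.sqrt N%:R * (Num.sqrt (4 * d%:R * ln (N%:R / sigma ^+ 2)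
                + 8 * ln (2 * K%:R / delta)) + 3 * Lphi).
  (* The bound depends on the sample only through which candidate is a maximizer, so [good] says
     that no candidate violating the bound is one: a finite intersection. *)
  have -> : good = \bigcap_(a in [set a | a \in s /\ ~~ concl a])
      ~` [set V | is_argmax_on [set` s] (Mhat^~ V) a].
    apply/seteqP; split => V.
      by move=> gV a /= [_ /negP na] /gV.
    move=> gV a aV; apply/negPn/negP => na.
    by apply: (gV a) => //; split => //; case: aV.
  apply: fin_bigcap_measurable => [|a _].
    by apply: sub_finite_set (finite_seq s) => a /= [].
  by apply: measurableC; apply: measurable_is_argmax.
split=> //.
apply: (@le_trans _ _ (iid_sample P N (~` B))).
  by rewrite probability_setC// EFinB leeB.
apply: le_measure; rewrite ?inE//; first exact: measurableC.
move=> V nBV a [/= sa amax].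
have dev b k : b \in s ->
    `|phi_hat ell V k (theta_hat b) - phi ell P k (theta_hat b)| <= t.
  move=> bs; rewrite ltW// ltNge; apply/negP => bk; apply: nBV.
  rewrite /B (big_rem (b, k))/=; first by left.
  by apply: allpairs_f => //; rewrite mem_enum.
have [b bs ab] := s_cover _ star1.
have cover_gap : metric ell Psi P (theta_hat alpha_star)
    - metric ell Psi P (theta_hat b) <= LPsi * (Num.sqrt K%:R * (Lphi * eps)).
  apply: l2_lipschitz_row => // [|k]; first by rewrite mulr_ge0// ltW.
  apply: le_trans (lipPhi k _ _ star1 (s1 _ bs)) _.
  by rewrite ler_wpM2l.
have b_gap : metric ell Psi P (theta_hat b) - Mhat b V
    <= LPsi * (Num.sqrt K%:R * t).
  apply: l2_lipschitz_row => // [|k]; first exact: ltW.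
  by rewrite distrC dev.
have a_gap : Mhat a V - metric ell Psi P (theta_hat a)
    <= LPsi * (Num.sqrt K%:R * t).
  by apply: l2_lipschitz_row => // [|k]; [exact: ltW|exact: dev].
(* The regret telescopes from [alpha_star] through M(b), Mhat(b) and Mhat(a) to M(a); the step from
   Mhat(b) to Mhat(a) is nonpositive because [a] maximizes [Mhat]. *)
have := amax b bs; rewrite -/(Mhat b V) -/(Mhat a V) => ba_gap.
have -> : 4 * d%:R * ln (N%:R / sigma ^+ 2) + 8 * ln (2 * K%:R / delta)
    = 2 ^+ 2 * E by rewrite /E; ring.
rewrite sqrtrM ?sqr_ge0// sqrtr_sqr ger0_norm//.
have -> : sigma * LPsi * Num.sqrt K%:R / Num.sqrt N%:R
      * (2 * Num.sqrt E + 3 * Lphi)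
    = LPsi * (Num.sqrt K%:R * t) *+ 2 + LPsi * (Num.sqrt K%:R * (Lphi * eps)).
  by rewrite /t /eps; ring.
rewrite mulr2n; lra.
Qed.
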